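(* Let $G$ be a finite group of order $n$. If $\psi(G) > \frac{31}{77}\,\psi(C_n)$, then $G$ is supersolvable.
   Context: All groups are finite. For a finite group $G$, $\psi(G)=\sum_{g\in G} o(g)$, where $o(g)$ is the order of $g$. $C_n$ denotes the cyclic group of order $n$. *)

(* Defs.v *)
From mathcomp Require Import all_boot all_order all_fingroup all_algebra all_solvable.
Set Implicit Arguments. Unset Strict Implicit. Unset Printing Implicit Defensive.
Local Open Scope group_scope.

Definition psi (gT : finGroupType) (G : {set gT}) : nat := (\sum_(x in G) #[x])%N.

Definition supersolvable (gT : finGroupType) (G : {group gT}) : Prop :=
  exists s : seq {group gT},
    [/\ path (fun H K : {group gT} => (H \subset K) && cyclic (K / H)) 1%G s,
        all (fun H : {group gT} => H <| G) s
      & last 1%G s = G].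

(* Main.v *)
Require Import Defs.
From mathcomp Require Import all_boot all_order all_fingroup all_algebra all_solvable.
From mathcomp Require Import zify ring.
Local Open Scope group_scope.

(** Since psi(C_n) is at least n^2 times the product of p/(p+1) over the primes
    p dividing n, the hypothesis gives a cyclic subgroup A of small index in G:
    if p is the largest prime divisor of n, the index is at most p for p >= 5,
    at most 4 for p = 3 and at most 3 for p = 2.

    If |G : A| < p, then A contains a Sylow p-subgroup P of G, which is normal
    because it has fewer than p + 1 conjugates. As psi(G) <= psi(P) psi(G/P) for
    P cyclic, one concludes by induction on G/P.

    If |G : A| is prime, then A is maximal. Either A is normal, or two distinct
    conjugates of A meet in a central subgroup; then |A : A :&: Z(G)| < |G : A|,
    so modulo this cyclic central subgroup the Sylow subgroup for the prime
    |G : A| is normal, with cyclic quotient.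

    There remains |G : A| = 4 and n = 2^i 3^j, with a Sylow 3-subgroup of A not
    normal in G. Then Z = A :&: Z(G) has index 3 in A, and G is the disjoint
    union of the four conjugates of A minus Z and of the product of a Sylow
    2-subgroup of G with the 3-part of Z. Summing orders over this partition
    gives psi(G) <= (31/77) psi(C_n), unless a Sylow 2-subgroup is cyclic, in
    which case G has a cyclic subgroup of index 3. *)

(** * Sums of orders over semidirect and direct products *)

Lemma psi_isog {aT rT : finGroupType} {G : {group aT}} {H : {group rT}} :
  G \isog H -> psi G = psi H.
Proof.
case/isogP=> f injf <-; rewrite /psi [in RHS]morphimEdom.
rewrite big_imset /=; last exact/injmP.
by apply: eq_bigr => x Gx; rewrite order_injm.
Qed.

Lemma psi_sdprod {gT : finGroupType} {K H G : {group gT}} :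
  K ><| H = G -> psi G = (\sum_(u in K) \sum_(h in H) #[u * h])%N.
Proof.
case/sdprodP=> _ defG _ tiKH; rewrite /psi -defG.
rewrite pair_big_dep /= -(big_imset (fun x => #[x]) (h := fun u => u.1 * u.2)) /=.
  apply: eq_bigl => x; apply/mulsgP/imsetP => [[u h Ku Hh ->] | [[u h] /=]].
    by exists (u, h) => //; apply/andP.
  by case/andP=> /= Ku Hh ->; exists u h.
move=> [u h] [v k] /andP[/= Ku Hh] /andP[/= Kv Hk] /= eq_uh.
have := divgrMid tiKH Ku Hh; have := remgrMid tiKH Ku Hh.
by rewrite eq_uh (divgrMid tiKH Kv Hk) (remgrMid tiKH Kv Hk) => -> ->.
Qed.

(** Every subgroup of the cyclic group [P] is characteristic, so [H] normalises [<[u]>] and the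
    order of [u * h] divides [#[u] * #[h]]. *)
Lemma psi_cyclic_sdprod_le {gT : finGroupType} {P H G : {group gT}} :
  cyclic P -> P ><| H = G -> psi G <= psi P * psi H.
Proof.
move=> cycP defG; rewrite (psi_sdprod defG) /psi big_distrl /=.
have [nPG _ _ nPH _] := sdprod_context defG.
apply: leq_sum => u Pu; rewrite big_distrr /=; apply: leq_sum => h Hh.
apply: dvdn_leq; first by rewrite muln_gt0 !order_gt0.
have nuH: <[u]> <| <[u]> <*> H.
  rewrite normalYl; apply: (char_norm_trans _ nPH).
  by rewrite sub_cyclic_char // cycle_subG.
have nuh: h \in 'N(<[u]>) by rewrite (subsetP _ h Hh) // -normalYl.
have nuu: u \in 'N(<[u]>) by rewrite (subsetP (normG _)) ?cycle_id.
(* <[u]> is normalised by H, so u * h and h agree modulo <[u]>. *)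
have: (u * h) ^+ #[h] \in <[u]>.
  rewrite coset_idr ?groupX ?groupM // morphX ?groupM // morphM //=.
  by rewrite (coset_id (cycle_id u)) mul1g -morphX // expg_order morph1.
rewrite order_dvdn mulnC expgM => /cycleP[k ->].
by rewrite -expgM mulnC expgM expg_order expg1n.
Qed.

Lemma psi_coprime_dprod {gT : finGroupType} {K H G : {group gT}} :
  coprime #|K| #|H| -> K \x H = G -> psi G = (psi K * psi H)%N.
Proof.
move=> coKH defG; have [_ _ cKH _] := dprodP defG.
rewrite dprodEsd // in defG; rewrite (psi_sdprod defG) /psi.
rewrite big_distrl /=; apply: eq_bigr => u Ku; rewrite big_distrr /=.
apply: eq_bigr => h Hh; apply: orderM; first exact/commute_sym/(centsP cKH).
by rewrite (coprime_dvdl (order_dvdG Ku)) // (coprime_dvdr (order_dvdG Hh)).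
Qed.

(** * Supersolvability of extensions by cyclic normal subgroups *)

Lemma supersolvable_cyclic_ext {gT : finGroupType} {N G : {group gT}} :
  N <| G -> cyclic N -> supersolvable (G / N)%G -> supersolvable G.
Proof.
move=> nsNG cycN [s [ch nor lst]].
pose f (K : {group coset_of N}) : {group gT} := [group of coset N @*^-1 K].
have f1 : f 1%G = N by apply/val_inj; rewrite /= cosetpre1.
exists (N :: map f s); split => /=; last first.
- have lastE K : K = N -> last K (map f s) = last N (map f s) by move=> ->.
  rewrite -(lastE _ f1) last_map.
  by rewrite lst; apply/val_inj; rewrite /= quotientGK.
- rewrite nsNG /= all_map; apply: sub_all nor => K nK /=.
  by rewrite -(quotientGK nsNG) cosetpre_normal.
rewrite sub1G quotient_cyclic //=.
(* As [N] is the preimage of the trivial group, the chain above [N] is the image under [f] of the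
   given one; the third isomorphism theorem compares the factors. *)
set e := fun H K : {group gT} => _; suff: path e (f 1%G) (map f s) by rewrite f1.
rewrite path_map; apply: (@sub_in_path _ (fun K : {group coset_of N} => K <| (G / N)%G)) ch; last first.
  by rewrite /= normal1.
move=> H K nH nK /= /andP[sHK cHK]; rewrite /e /= cosetpreSK sHK /=.
have nHK: H <| K by rewrite /normal sHK (subset_trans (normal_sub nK)) // normal_norm.
have sNf: N \subset f H by rewrite /= sub_cosetpre.
have nNf: N <| f K by rewrite /normal sub_cosetpre subsetIl.
rewrite -(isog_cyclic (third_isog (K := f H) (G := f K) sNf nNf _)) /=.
  by rewrite !cosetpreK.
by rewrite /= cosetpre_normal.
Qed.

Lemma cyclic_supersolvable {gT : finGroupType} {G : {group gT}} :
  cyclic G -> supersolvable G.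
Proof.
by move=> cycG; exists [:: G]; rewrite /= sub1G quotient_cyclic // normal_refl.
Qed.

(** * Abelian maximal subgroups and the centre *)

(* Two distinct conjugates generate G and both centralise their intersection. *)
Lemma abelian_maximal_TI_center {gT : finGroupType} {A G : {group gT}} x y :
    abelian A -> maximal A G -> x \in G -> y \in G -> A :^ x != A :^ y ->
  A :^ x :&: A :^ y \subset 'Z(G).
Proof.
move=> abA maxA Gx Gy neqA; have [sAG _] := andP (maxgroupp maxA).
have maxAx : maximal (A :^ x) G by rewrite -(conjGid Gx) maximalJ.
have sAyG : A :^ y \subset G by rewrite -(conjGid Gy) conjSg.
have defG : (A :^ x) <*> (A :^ y) = G.
  have [_ maxJ] := maxgroupP maxAx; apply/eqP; apply: contraR neqA => neqG.
  have sJG : (A :^ x) <*> (A :^ y) \subset G by rewrite join_subG -{1}(conjGid Gx) conjSg sAG.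
  have := maxJ ((A :^ x) <*> (A :^ y))%G.
  rewrite properEneq neqG sJG joing_subl => /(_ isT isT)/= defA.
  by have := joing_subr (A :^ x) (A :^ y); rewrite defA eq_sym eqEcard => ->; rewrite !cardJg /=.
rewrite subsetI (subset_trans (subsetIr _ _)) //= -defG centY subsetI.
have abAx z : A :^ z \subset 'C(A :^ z) by rewrite -/(abelian _) abelianJ.
by rewrite !subIset ?abAx ?orbT.
Qed.

(** If [A :^ y] differs from [A], their intersection is central and their product is not all of [G],
    so |A|^2 < |G| |A :&: 'Z(G)|. *)
Lemma abelian_maximal_center_index {gT : finGroupType} {A G : {group gT}} :
  abelian A -> maximal A G -> ~~ (A <| G) -> #|A| < #|G : A| * #|A :&: 'Z(G)|.
Proof.
move=> abA maxA nnA; have [sAG _] := andP (maxgroupp maxA).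
have [y Gy neqA] : exists2 y, y \in G & A :^ 1 != A :^ y.
  apply/exists_inP; apply: contraR nnA; rewrite negb_exists_in => /forall_inP eqA.
  rewrite /normal sAG; apply/normsP=> y Gy; apply/esym/eqP.
  by move: (eqA y Gy); rewrite negbK conjsg1.
have sZ := abelian_maximal_TI_center 1 y abA maxA (group1 G) Gy neqA.
have sAyG : A :^ y \subset G by rewrite -(conjGid Gy) conjSg.
have ltAA : #|A * A :^ y| < #|G|.
  rewrite proper_card // properE mul_subG //=; apply: contra neqA => sG.
  (* If [y = a * c ^ y] with [a] and [c] in [A], then [y = c * a] lies in [A]. *)
  have /mulsgP[a b Aa] := subsetP sG y Gy; case/imsetP=> c Ac -> eqy.
  have Ay : y \in A.
    rewrite -groupV (_ : y^-1 = a^-1 * c^-1) ?groupM ?groupV //.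
    by apply: (mulgI a); apply: (mulIg c); rewrite mulKVg mulVg;
      apply: (mulIg y); rewrite mul1g -!mulgA -/(c ^ y) -eqy.
  by rewrite conjsg1 conjGid.
have:= mul_cardG A (A :^ y); rewrite cardJg => eqAA.
have leZ : #|A :&: A :^ y| <= #|A :&: 'Z(G)|.
  by rewrite subset_leq_card // subsetI subsetIl -{1}(conjsg1 A).
rewrite -(ltn_pmul2l (cardG_gt0 A)) eqAA mulnA Lagrange //.
apply: leq_trans (_ : #|G| * #|A :&: A :^ y| <= _); last by rewrite leq_mul2l leZ orbT.
by rewrite ltn_pmul2r.
Qed.

(** * Values of [psi] on cyclic groups *)

Definition psi_Zp n := psi (Zp n).

Lemma cyclic_Zp n : cyclic (Zp n).
Proof.
rewrite /Zp; case: ifP => _; last exact: cyclic1.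
by apply/cyclicP; exists Zp1; apply: Zp_cycle.
Qed.

Lemma psi_cyclic {gT : finGroupType} {G : {group gT}} :
  cyclic G -> psi G = psi_Zp #|G|.
Proof.
move=> cycG; apply: (psi_isog (H := Zp_group #|G|)).
by rewrite isog_cyclic_card // cyclic_Zp card_Zp //=.
Qed.

Lemma psi_Zp_partn (pi : nat_pred) n :
  0 < n -> psi_Zp n = (psi_Zp n`_pi * psi_Zp n`_pi^')%N.
Proof.
move=> n_gt0; pose G := Zp_group n; have cycG : cyclic G := cyclic_Zp n.
have nilG := abelian_nil (cyclic_abelian cycG).
have defG := nilpotent_pcoreC pi nilG.
have cyc rho : psi 'O_rho(G) = psi_Zp n`_rho.
  rewrite psi_cyclic ?(cyclicS (pcore_sub _ _)) //.
  by rewrite (card_Hall (nilpotent_pcore_Hall rho nilG)) card_Zp.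
rewrite -[in RHS]cyc -cyc; apply: psi_coprime_dprod defG.
by rewrite (pnat_coprime (pcore_pgroup _ _) (pcore_pgroup _ _)).
Qed.

Lemma psi_Zp_coprime m n :
  0 < m -> 0 < n -> coprime m n -> psi_Zp (m * n) = (psi_Zp m * psi_Zp n)%N.
Proof.
move=> m_gt0 n_gt0 co_mn; rewrite (psi_Zp_partn \pi(m)) ?muln_gt0 ?m_gt0 //.
have m'n : \pi(m)^'.-nat n by rewrite -coprime_pi'.
have -> : ((m * n)`_\pi(m) = m)%N.
  by rewrite partnM // (part_pnat_id (pnat_pi m_gt0)) part_p'nat ?muln1.
rewrite partnM // (part_pnat_id m'n) part_p'nat ?mul1n //.
by rewrite pnatNK pnat_pi.
Qed.

(** Induction on [a]: the elements outside [<[x ^+ p]>] are exactly the generators of [<[x]>]. The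
    factor [p.+1] clears the denominator of the geometric sum. *)
Lemma psi_cycle_pfactor {gT : finGroupType} (p a : nat) (x : gT) :
  prime p -> #[x] = (p ^ a)%N -> (p.+1 * psi <[x]> = (p ^ a) ^ 2 * p + 1)%N.
Proof.
move=> p_pr; have p_gt0 := prime_gt0 p_pr; elim: a x => [|a IHa] x ox.
  by move/eqP: ox; rewrite order_eq1 => /eqP->; rewrite /psi cycle1 big_set1 order1 addn1 muln1 mul1n.
have oxp : #[x ^+ p] = (p ^ a)%N by rewrite orderXdiv ox expnS ?dvdn_mulr // mulKn.
have sxp : <[x ^+ p]> \subset <[x]> by exact: cycleX.
have := IHa _ oxp; rewrite /psi => IH; rewrite (big_setID <[x ^+ p]>) /= (setIidPr sxp) mulnDr IH.
rewrite (eq_bigr (fun _ => p ^ a.+1)%N) => [|y /setDP[xy nxpy]]; last first.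
  have /(dvdn_pfactor _ _ p_pr)[b leb oy] : #[y] %| p ^ a.+1 by rewrite -ox order_dvdG.
  move: leb; rewrite leq_eqVlt => /predU1P[<- //|ltb]; case/negP: nxpy.
  rewrite -cycle_subG -(cardSg_cyclic (cycle_cyclic x)) ?cycle_subG ?groupX ?cycle_id //.
  by rewrite -!orderE oy oxp dvdn_exp2l.
rewrite sum_nat_const cardsDS // -!orderE ox oxp (expnS p).
case: p p_gt0 {p_pr IHa ox oxp sxp IH} => // p _.
move: (_ ^ a)%N => P; rewrite (_ : (p.+1 * P - P = p * P)%N); last by rewrite mulSn addKn.
by nia.
Qed.

Lemma psi_Zp_pfactor p a :
  prime p -> (p.+1 * psi_Zp (p ^ a) = (p ^ a) ^ 2 * p + 1)%N.
Proof.
move=> p_pr; have pa_gt0 : 0 < p ^ a by rewrite expn_gt0 prime_gt0.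
have /cyclicP[x def] := cyclic_Zp (p ^ a).
by rewrite /psi_Zp def (psi_cycle_pfactor p a) // orderE -def card_Zp.
Qed.

Lemma psi_Zp_gt0 n : 0 < psi_Zp n.
Proof. by rewrite /psi_Zp /psi (bigD1 1) ?group1 // order1. Qed.

(** * Lower bounds for [psi_Zp] in terms of the largest prime divisor *)

Definition smooth m n := forall p, prime p -> p %| n -> p <= m.

(** Splitting off the p-part for p = [m.+1] costs a factor p / (p + 1), by [psi_Zp_pfactor]; the
    remaining p'-part is [m]-smooth. *)
Lemma smooth_bound_step m k c :
    (forall n, 0 < n -> smooth m n -> k * n ^ 2 <= c * psi_Zp n)%N -> prime m.+1 ->
  forall n, (0 < n -> smooth m.+1 n -> m.+1 * k * n ^ 2 <= m.+2 * c * psi_Zp n)%N.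
Proof.
move=> IH p_pr n n_gt0 smn; set p := m.+1 in p_pr smn *.
have smn' : smooth m n`_p^'.
  move=> r r_pr r_n; have := smn r r_pr (dvdn_trans r_n (dvdn_part _ _)).
  rewrite leq_eqVlt => /predU1P[def_r|//].
  have /(pnatP _ (part_gt0 _ _))/(_ r r_pr r_n) := part_pnat p^' n.
  by rewrite !inE def_r eqxx.
have:= IH _ (part_gt0 _ _) smn'; have := psi_Zp_pfactor p (logn p n) p_pr.
rewrite -p_part => psi_p le_p'.
rewrite (psi_Zp_partn p n n_gt0) -[in X in X <= _](partnC p n_gt0).
move: (n`_p)%N (n`_p^')%N psi_p le_p' => a b.
move: (psi_Zp a) (psi_Zp b) => u v; rewrite /p => psi_p le_p'.
have -> : (m.+1 * k * (a * b) ^ 2 = (a ^ 2 * m.+1) * (k * b ^ 2))%N by rewrite expnMn; ring.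
have -> : (m.+2 * c * (u * v) = m.+2 * u * (c * v))%N by ring.
by rewrite psi_p; apply: leq_mul; rewrite ?leq_addr.
Qed.

Lemma smooth1_bound n : 0 < n -> smooth 1 n -> (1 * n ^ 2 <= 1 * psi_Zp n)%N.
Proof.
case: n => [|[|n]] // _ sm; first by rewrite exp1n !mul1n psi_Zp_gt0.
by have := sm _ (pdiv_prime (isT : 1 < n.+2)) (pdiv_dvd _); rewrite leqNgt prime_gt1 ?pdiv_prime.
Qed.

Lemma smooth2_bound n : 0 < n -> smooth 2 n -> (2 * n ^ 2 <= 3 * psi_Zp n)%N.
Proof. exact (smooth_bound_step 1 1 1 smooth1_bound isT n). Qed.

Lemma smooth3_bound n : 0 < n -> smooth 3 n -> (6 * n ^ 2 <= 12 * psi_Zp n)%N.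
Proof. exact (smooth_bound_step 2 2 3 smooth2_bound isT n). Qed.

Lemma smooth4_bound n : 0 < n -> smooth 4 n -> (6 * n ^ 2 <= 12 * psi_Zp n)%N.
Proof.
move=> n_gt0 sm; apply: smooth3_bound => // p p_pr pn.
by have := sm p p_pr pn; rewrite leq_eqVlt => /predU1P[def_p|//]; rewrite def_p in p_pr.
Qed.

(* Consecutive steps telescope, since [m.+1] is both the bound for [m] and the
   prime adjoined; the induction can start at [m = 4] as 77 / 31 * 2 <= 5. *)
Lemma smooth_bound m n :
  3 < m -> 0 < n -> smooth m n -> (77 * n ^ 2 <= 31 * m.+1 * psi_Zp n)%N.
Proof.
move=> m_gt3; elim: m m_gt3 n => // m IHm; rewrite ltnS leq_eqVlt.
case/predU1P=> [<-|/IHm{}IHm] n n_gt0 sm.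
  by have := smooth4_bound n n_gt0 sm; nia.
have [m_pr|m_npr] := boolP (prime m.+1).
  have := smooth_bound_step _ _ _ IHm m_pr n n_gt0 sm.
  by rewrite -mulnA [X in _ <= X -> _]mulnAC -!mulnA mulnCA; nia.
have := IHm n n_gt0; rewrite mulnS => IH; apply: leq_trans (IH _) _; last by nia.
move=> p p_pr pn; have := sm p p_pr pn; rewrite leq_eqVlt => /predU1P[def_p|//].
by rewrite def_p (negPf m_npr) in p_pr.
Qed.

(** * Normal Sylow subgroups and cyclic subgroups of prime index *)

(** The index counts the Sylow p-subgroups; being congruent to 1 modulo [p] and at most [p], it is
    1. *)
Lemma Sylow_norm_index_le_normal {gT : finGroupType} {p : nat} {P G : {group gT}} :
  prime p -> p.-Sylow(G) P -> #|G : 'N_G(P)| <= p -> P <| G.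
Proof.
move=> p_pr sylP le_p; have := card_Syl_mod G p_pr; rewrite (card_Syl sylP).
have p_gt1 := prime_gt1 p_pr; move: le_p; rewrite leq_eqVlt => /predU1P[->|lt_p].
  by rewrite modnn.
rewrite modn_small // => /eqP; rewrite indexg_eq1 subsetI subxx /= => nPG.
by rewrite /normal nPG (pHall_sub sylP).
Qed.

Lemma cyclic_prime_index_supersolvable {gT : finGroupType} {A G : {group gT}} :
  A \subset G -> cyclic A -> prime #|G : A| -> supersolvable G.
Proof.
move=> sAG cycA p_pr; have [nAG|nnAG] := boolP (A <| G).
  apply: (supersolvable_cyclic_ext nAG cycA); apply: cyclic_supersolvable.
  by rewrite prime_cyclic // card_quotient ?normal_norm.
have abA := cyclic_abelian cycA.
have ltAZ := abelian_maximal_center_index abA (p_index_maximal sAG p_pr) nnAG.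
set p := #|G : A| in p_pr ltAZ; pose Z := (A :&: 'Z(G))%G.
have sZA : Z \subset A := subsetIl _ _.
have nZG : Z <| G by apply: sub_center_normal; apply: subsetIr.
have nZA : A \subset 'N(Z) := subset_trans sAG (normal_norm nZG).
apply: (supersolvable_cyclic_ext nZG (cyclicS sZA cycA)).
have lt_p : #|A / Z| < p.
  by rewrite card_quotient // -(ltn_pmul2l (cardG_gt0 Z)) Lagrange // mulnC.
have cardGZ : #|G / Z| = (p * #|A / Z|)%N.
  by rewrite (card_quotient (normal_norm nZG)) (card_quotient nZA) -(Lagrange_index sAG sZA).
have p'A : ~~ (p %| #|A / Z|).
  by apply/negP=> /(dvdn_leq (cardG_gt0 _)); rewrite leqNgt lt_p.
have [S sylS] := Sylow_exists p (G / Z).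
have cardS : #|S| = p.
  by rewrite (card_Hall sylS) cardGZ p_part lognM ?cardG_gt0 ?prime_gt0 // logn_prime //
    eqxx (lognE p #|_|) p_pr cardG_gt0 (negPf p'A) addn0.
have sSG := pHall_sub sylS.
have idxS : #|G / Z : S| = #|A / Z|.
  by apply/eqP; rewrite -(eqn_pmul2l (prime_gt0 p_pr)) -{1}cardS Lagrange // cardGZ.
(* [S] has index [#|A / Z|] in [G / Z], which is less than [p], so the Sylow count applies. *)
have nSG : S <| (G / Z)%G.
  apply: Sylow_norm_index_le_normal p_pr sylS _; apply: leq_trans (ltnW lt_p).
  by rewrite -idxS; apply/(dvdn_leq (indexg_gt0 _ _))/indexgS; rewrite subsetI sSG normG.
apply: (supersolvable_cyclic_ext nSG); first by rewrite prime_cyclic // cardS.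
apply: cyclic_supersolvable => /=.
have coSA : coprime #|S| #|A / Z| by rewrite cardS prime_coprime.
(* Hence the quotient of [G / Z] by [S] is an image of the cyclic group [A]. *)
have defG : S * (A / Z) = G / Z.
  by apply/eqP; rewrite eqEcard mul_subG ?quotientS //= coprime_cardMg // cardS cardGZ.
by rewrite -defG quotientMidl !quotient_cyclic.
Qed.

(** * Cyclic subgroups of index four *)

Lemma Sylow_p'index {gT : finGroupType} {p : nat} {P A G : {group gT}} :
  A \subset G -> ~~ (p %| #|G : A|) -> p.-Sylow(A) P -> prime p -> p.-Sylow(G) P.
Proof.
move=> sAG p'i /and3P[sPA pP p'iP] p_pr; apply/and3P; split=> //.
  exact: subset_trans sAG.
by rewrite -(Lagrange_index sAG sPA) pnatM p'iP andbT p'natE.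
Qed.

(** Distinct conjugates of [A] meet inside the centre, so the [#|G : A|] conjugates of [A :\: 'Z(G)]
    are pairwise disjoint. By the cardinality hypothesis they and [N] partition [G], and conjugation
    preserves orders. *)
Lemma psi_maximal_conjugates {gT : finGroupType} {A N G : {group gT}} :
    abelian A -> maximal A G -> ~~ (A <| G) -> N \subset G ->
    {in G, forall y, [disjoint N & (A :\: 'Z(G)) :^ y]} ->
    (#|N| + #|G : A| * #|A :\: 'Z(G)| = #|G|)%N ->
  psi G = (psi N + #|G : A| * psi (A :\: 'Z(G)))%N.
Proof.
move=> abA maxA nnA sNG dis cardG; have [sAG _] := andP (maxgroupp maxA).
set D := A :\: 'Z(G) in dis cardG *.
have nZG : 'N_G('Z(G)) = G by apply/setIidPl; rewrite normal_norm ?center_normal.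
have nZ y : y \in G -> 'Z(G) :^ y = 'Z(G).
  by move=> Gy; apply: normP; move: Gy; rewrite -{1}nZG => /setIP[].
have DJ y : y \in G -> D :^ y = A :^ y :\: 'Z(G).
  by move=> Gy; rewrite conjDg nZ.
have TI y z w : y \in G -> z \in G -> w \in D :^ y -> w \in D :^ z -> A :^ y = A :^ z.
  move=> Gy Gz; rewrite !DJ // => /setDP[Ayw nZw] /setDP[Azw _].
  apply/eqP; apply: contraR nZw => neqA.
  by rewrite (subsetP (abelian_maximal_TI_center _ _ abA maxA Gy Gz neqA)) // inE Ayw.
have sAN : A \subset 'N_G(D).
  rewrite subsetI sAG; apply/normsP=> y Ay.
  by rewrite DJ ?(subsetP sAG) // conjGid.
have defN : 'N_G(D) = A.
  have [_ maxN] := maxgroupP maxA.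
  have [prN|] := boolP ('N_G(D) \proper G).
    exact: maxN.
  rewrite properE subsetIl negbK /= => sGN; case/negP: nnA.
  (* If [G] normalised [D], then [A] would be normal: it is central when [D] is empty, and otherwise
     some [w] in [D] lies in every conjugate of [D]. *)
  have [D0|[w Dw]] := set_0Vmem D.
    apply: sub_center_normal; apply/subsetP=> w Aw; apply: contraT => nZw.
    by have := in_set0 w; rewrite -D0 /D inE Aw nZw.
  rewrite /normal sAG; apply/normsP=> y Gy.
  have nDy : y \in 'N(D) by have := subsetP sGN y Gy; rewrite inE => /andP[].
  by rewrite -(TI 1 y w) ?conjsg1 // (normP nDy).
have tiP : trivIset (D :^: G).
  apply/trivIsetP=> _ _ /imsetP[y Gy ->] /imsetP[z Gz ->]; apply: contraNT => ndis.
  have /pred0Pn[w /andP[/= wy wz]] := ndis.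
  by rewrite !DJ // (TI y z w).
have cardP : #|D :^: G| = #|G : A| by rewrite card_conjugates defN.
have sumP E : (forall y, y \in G -> \sum_(w in D :^ y) E w = \sum_(w in D) E w) ->
    \sum_(w in cover (D :^: G)) E w = (#|G : A| * \sum_(w in D) E w)%N.
  move=> EJ; rewrite big_trivIset //= -cardP -sum_nat_const.
  by apply: eq_bigr => _ /imsetP[y Gy ->]; apply: EJ.
have sUG : cover (D :^: G) \subset G.
  apply/bigcupsP=> _ /imsetP[y Gy ->]; rewrite -(conjGid Gy) conjSg.
  exact: subset_trans (subsetDl _ _) sAG.
have disU : [disjoint N & cover (D :^: G)].
  by apply/bigcup_disjointP=> _ /imsetP[y Gy ->]; apply: dis.
have cardU : #|cover (D :^: G)| = (#|G : A| * #|D|)%N.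
  by rewrite -sum1_card sumP ?sum1_card // => y _; rewrite !sum1_card cardJg.
have defG : G :=: N :|: cover (D :^: G).
  apply/esym/eqP; rewrite eqEcard subUset sNG sUG /= -cardG cardsU cardU.
  by move: disU; rewrite -setI_eq0 => /eqP->; rewrite cards0 subn0.
rewrite /psi [in LHS]defG (eq_bigl [in [predU N & cover (D :^: G)]]) => [|w]; last first.
  by rewrite !inE.
rewrite bigU // sumP // => y Gy.
by rewrite (big_imset _ (in2W (conjg_inj y))); apply: eq_bigr => w _; rewrite orderJ.
Qed.

(** The index of [A :&: 'Z(G)] in [A] is below 4; were it prime to 3, ['O_3(A)] would be central,
    hence normal. *)
Lemma index4_center_index3 {gT : finGroupType} {A G : {group gT}} :
    A \subset G -> cyclic A -> #|G : A| = 4 -> ~~ ('O_3(A) <| G) ->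
  maximal A G /\ #|A| = (3 * #|A :&: 'Z(G)|)%N.
Proof.
move=> sAG cycA iA nnT; have abA := cyclic_abelian cycA.
have sylTA : 3.-Sylow(A) 'O_3(A) := nilpotent_pcore_Hall 3 (abelian_nil abA).
have sylT : 3.-Sylow(G) 'O_3(A) by apply: Sylow_p'index sAG _ sylTA isT; rewrite iA.
have nnA : ~~ (A <| G).
  by apply: contra nnT => nAG; apply: gFnormal_trans.
have maxA : maximal A G.
  apply/maxgroupP; split=> [|H prH sAH].
    by rewrite properEneq sAG andbT; apply/eqP=> eqAG; rewrite eqAG indexgg in iA.
  have [sHG neqHG] := andP prH; apply/eqP; rewrite eq_sym eqEsubset sAH /=.
  rewrite -indexg_eq1; apply: contraR nnT => iHA; have := Lagrange_index sHG sAH.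
  have : #|G : H| != 1%N by rewrite indexg_eq1.
  rewrite iA; move: iHA; have := indexg_gt0 H A; have := indexg_gt0 G H.
  move=> iGH_gt0 iHA_gt0 iHA1 iGH1 i4.
  (* A group strictly between would give two normal steps of index 2, making ['O_3(A)] equal to
     ['O_3(H)] and so normal in [G]. *)
  have [iGH iHA] : #|G : H| = 2 /\ #|H : A| = 2 by nia.
  have nAH : A <| H := index2_normal sAH iHA.
  have nHG : H <| G := index2_normal sHG iGH.
  have sylTH : 3.-Sylow(H) 'O_3(A) by apply: Sylow_p'index sAH _ sylTA isT; rewrite iHA.
  have nTH : 'O_3(A) <| H by apply: gFnormal_trans.
  by rewrite -(normal_Hall_pcore sylTH nTH) gFnormal_trans.
split=> //; have := abelian_maximal_center_index abA maxA nnA.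
set Z := (A :&: 'Z(G))%G; have sZA : Z \subset A := subsetIl _ _.
have nZG : Z <| G by apply: sub_center_normal; apply: subsetIr.
rewrite -(Lagrange sZA) iA mulnC ltn_pmul2r ?cardG_gt0 // => lt4.
have [i3|ni3] := boolP (3 %| #|A : Z|).
  by congr (_ * _)%N; move/dvdnP: i3 (indexg_gt0 A Z) lt4 => [k ->]; lia.
case/negP: nnT; have sTZ : 'O_3(A) \subset Z.
  rewrite -(cardSg_cyclic cycA) ?pcore_sub //.
  have coT : coprime #|'O_3(A)| #|A : Z|.
    by apply: pnat_coprime (pcore_pgroup 3 A) _; rewrite p'natE.
  by rewrite -(Gauss_dvdl _ coT) Lagrange // cardSg ?pcore_sub.
by apply: sub_center_normal; apply: subset_trans sTZ (subsetIr _ _).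
Qed.

Lemma smooth3_pfactors n : 0 < n -> smooth 3 n -> exists a b, n = (2 ^ a * 3 ^ b)%N.
Proof.
move=> n_gt0 sm; exists (logn 2 n); exists (logn 3 n).
rewrite -{1}(partnC 2 n_gt0) p_part; congr (_ * _)%N.
rewrite -p_part; apply: eq_in_partn => p; rewrite mem_primes => /and3P[p_pr _ pn].
by have := sm p p_pr pn; rewrite !inE; case: p p_pr {pn} => [|[|[|[|p]]]].
Qed.

(* Here x = (2^a)^2, y = (3^b)^2, and u, v, w, t are the values of psi on the
   cyclic groups of order 2^a, 3^b, 3^(b+1), 2^(a+2). Equality holds for
   x = y = 1, which is the case of the alternating group of degree 4. *)
Lemma psi_bound_arith (x y u v w t : nat) :
    (0 < x -> 0 < y -> 3 * u = x * 2 + 1 -> 4 * v = y * 3 + 1 ->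
    4 * w = 9 * y * 3 + 1 -> 3 * t = 16 * x * 2 + 1 ->
  77 * ((u + 6 * x) * v + 4 * (u * w - u * v)) <= 31 * (t * w))%N.
Proof.
move=> x_gt0 y_gt0 eu ev ew et.
have le_vw : (u * v <= u * w)%N by rewrite leq_mul2l; lia.
have xy1 : (x <= x * y)%N by rewrite leq_pmulr.
have xy2 : (y <= x * y)%N by rewrite leq_pmull.
(* The factor 12 clears the denominators 3 and 4. After expansion the product [x * y] becomes a
   variable bounded below by [x] and [y], so the goal is linear. *)
suff: (77 * (12 * ((u + 6 * x) * v) + 4 * (12 * (u * w) - 12 * (u * v))) <= 31 * (12 * (t * w)))%N by lia.
have -> : (12 * ((u + 6 * x) * v) = (x * 2 + 1 + 18 * x) * (y * 3 + 1))%N.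
  by rewrite -eu -ev; ring.
have -> : (12 * (u * w) = (x * 2 + 1) * (9 * y * 3 + 1))%N by rewrite -eu -ew; ring.
have -> : (12 * (u * v) = (x * 2 + 1) * (y * 3 + 1))%N by rewrite -eu -ev; ring.
have -> : (12 * (t * w) = (16 * x * 2 + 1) * (9 * y * 3 + 1))%N by rewrite -et -ew; ring.
rewrite -mulnBr (_ : 9 * y * 3 + 1 - (y * 3 + 1) = 24 * y)%N; last by lia.
have -> : ((x * 2 + 1 + 18 * x) * (y * 3 + 1) = 60 * (x * y) + 20 * x + 3 * y + 1)%N by ring.
have -> : ((x * 2 + 1) * (24 * y) = 48 * (x * y) + 24 * y)%N by ring.
have -> : ((16 * x * 2 + 1) * (9 * y * 3 + 1) = 864 * (x * y) + 32 * x + 27 * y + 1)%N by ring.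
by move: (x * y)%N xy1 xy2 => z; lia.
Qed.

Lemma part2_pfactors a b : ((2 ^ a * 3 ^ b)`_2 = 2 ^ a)%N.
Proof. by rewrite partnM ?expn_gt0 // part_pnat_id ?pnatX // part_p'nat ?muln1 // pnatX. Qed.

Lemma part3_pfactors a b : ((2 ^ a * 3 ^ b)`_3 = 3 ^ b)%N.
Proof. by rewrite partnM ?expn_gt0 // mulnC part_pnat_id ?pnatX // part_p'nat ?muln1 // pnatX. Qed.

Lemma psi_cyclic_index4 {gT : finGroupType} {A G : {group gT}} :
    A \subset G -> cyclic A -> #|G : A| = 4 -> ~~ ('O_3(A) <| G) -> smooth 3 #|G| ->
  supersolvable G \/ (77 * psi G <= 31 * psi_Zp #|G|)%N.
Proof.
move=> sAG cycA iA nnT smG; have abA := cyclic_abelian cycA.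
have [maxA cardA] := index4_center_index3 sAG cycA iA nnT.
have nnA : ~~ (A <| G) by apply: contra nnT => nAG; apply: gFnormal_trans.
set Z := (A :&: 'Z(G))%G in cardA.
have sZA : Z \subset A := subsetIl _ _.
have sZZ : Z \subset 'Z(G) := subsetIr _ _.
have nZG : Z <| G := sub_center_normal sZZ.
have cycZ : cyclic Z := cyclicS sZA cycA.
have [a [b cardZ]] : exists a b, #|Z| = (2 ^ a * 3 ^ b)%N.
  apply: smooth3_pfactors => // p p_pr pZ; apply: smG => //.
  exact: dvdn_trans pZ (cardSg (normal_sub nZG)).
have cardG : #|G| = (2 ^ a.+2 * 3 ^ b.+1)%N.
  by rewrite -(Lagrange sAG) iA cardA cardZ !expnS; ring.
rewrite cardZ in cardA.
pose T := 'O_3(Z)%G; have sTZ : T \subset Z := pcore_sub 3 Z.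
have cardT : #|T| = (3 ^ b)%N.
  rewrite (card_Hall (nilpotent_pcore_Hall 3 (abelian_nil (cyclic_abelian cycZ)))).
  by rewrite cardZ part3_pfactors.
have [Q sylQ] := Sylow_exists 2 G; have sQG := pHall_sub sylQ.
have cardQ : #|Q| = (2 ^ a.+2)%N by rewrite (card_Hall sylQ) cardG part2_pfactors.
have coQT : coprime #|Q| #|T| by rewrite cardQ cardT coprimeXl ?coprimeXr.
have cQT : T \subset 'C(Q).
  apply: subset_trans (subset_trans sTZ (subset_trans sZZ (subsetIr _ _))) _.
  exact: centS.
have defN : Q \x T = Q <*> T by rewrite dprodEY // coprime_TIg.
have cardN : #|Q <*> T| = (4 * #|Z|)%N.
  by rewrite -(dprod_card defN) cardQ cardT cardZ !expnS; ring.
have sNG : Q <*> T \subset G.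
  by rewrite join_subG sQG (subset_trans sTZ) // normal_sub.
(* If Q is cyclic, then Q <*> T is a cyclic subgroup of index 3. *)
have [/exists_inP[g Qg /eqP og]|] := boolP [exists g in Q, #[g] == (2 ^ a.+2)%N].
  left; apply: (cyclic_prime_index_supersolvable sNG).
    rewrite (cyclic_dprod defN) ?(cyclicS sTZ) //.
    by apply/cyclicP; exists g; apply/eqP; rewrite eq_sym eqEcard cycle_subG Qg cardQ -orderE og /=.
  suff -> : #|G : Q <*> T| = 3 by [].
  apply/eqP; rewrite -(eqn_pmul2l (cardG_gt0 (Q <*> T))) Lagrange //= cardN cardG cardZ.
  by rewrite !expnS; apply/eqP; ring.
rewrite negb_exists_in => /forall_inP noQ; right.
(* An element of both groups has order dividing gcd(4|Z|, 3|Z|) = |Z|, and a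
   cyclic group has only one subgroup of each order. *)
have dis : {in G, forall y, [disjoint Q <*> T & (A :\: 'Z(G)) :^ y]}.
  move=> y Gy; rewrite disjoint_subset; apply/subsetP=> w Nw; rewrite inE /=.
  have nZy : 'Z(G) :^ y = 'Z(G).
    by apply: normP; rewrite (subsetP _ y Gy) // normal_norm ?center_normal.
  rewrite conjDg nZy inE; apply/andP=> [[/negP nZw Ayw]]; apply: nZw.
  have sZAy : Z \subset A :^ y.
    by rewrite -(normP (subsetP (normal_norm nZG) y Gy)) conjSg.
  have cycAy : cyclic (A :^ y) by rewrite cyclicJ.
  apply: (subsetP sZZ); rewrite -cycle_subG -(cardSg_cyclic cycAy) ?cycle_subG //.
  have: #[w] %| gcdn (4 * #|Z|) (3 * #|Z|).
    rewrite dvdn_gcd -cardN cardZ -cardA -(cardJg A y).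
    by apply/andP; split; apply: order_dvdG.
  by rewrite -muln_gcdl mul1n.
have cardD : #|A :\: 'Z(G)| = (2 * #|Z|)%N.
  have cardAZ : #|A :&: 'Z(G)| = (2 ^ a * 3 ^ b)%N := cardZ.
  by rewrite cardsD cardAZ cardA; rewrite -[X in (_ - X)%N]mul1n -mulnBl.
(* In units of [#|Z|] the count is 4 + 4 * 2 = 12. *)
have cardND : (#|Q <*> T| + #|G : A| * #|A :\: 'Z(G)| = #|G|)%N.
  by rewrite cardN cardD iA cardG cardZ !expnS; ring.
rewrite (psi_maximal_conjugates abA maxA nnA sNG dis cardND) iA.
rewrite (psi_coprime_dprod coQT defN).
have psiZ : psi Z = (psi_Zp (2 ^ a) * psi_Zp (3 ^ b))%N.
  by rewrite (psi_cyclic cycZ) cardZ psi_Zp_coprime ?expn_gt0 // coprimeXl ?coprimeXr.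
have psiA : psi A = (psi_Zp (2 ^ a) * psi_Zp (3 ^ b.+1))%N.
  rewrite (psi_cyclic cycA) cardA mulnCA -expnS.
  by rewrite psi_Zp_coprime ?expn_gt0 // coprimeXl ?coprimeXr.
have psiD : psi (A :\: 'Z(G)) = (psi A - psi Z)%N.
  by rewrite [psi A](big_setID 'Z(G)) /= addKn.
have psiT : psi T = psi_Zp (3 ^ b) by rewrite psi_cyclic ?(cyclicS sTZ) // cardT.
(* [Q :&: Z] is cyclic of order 2^a. The other 3 * 2^a elements of [Q] have order at most 2^(a+1),
   as [noQ] excludes order 2^(a+2). *)
have psiQ : psi Q <= psi_Zp (2 ^ a) + 6 * (2 ^ a) ^ 2.
  have cardQZ : #|Q :&: Z| = (2 ^ a)%N.
    by rewrite (card_Hall (Hall_setI_normal nZG sylQ)) cardZ part2_pfactors.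
  rewrite [psi Q](big_setID Z) /=; apply: leq_add.
    by rewrite -cardQZ -psi_cyclic // (cyclicS (subsetIr _ _) cycZ).
  have card_diff : (2 ^ a.+2 - 2 ^ a = 3 * 2 ^ a)%N.
    by rewrite !expnS mulnA -[X in (_ - X)%N]mul1n -mulnBl.
  have -> : (6 * (2 ^ a) ^ 2 = \sum_(g in Q :\: Z) 2 ^ a.+1)%N.
    by rewrite sum_nat_const cardsD cardQZ cardQ card_diff (expnS 2 a); ring.
  apply: leq_sum => g /setDP[Qg _].
  have: #[g] %| 2 ^ a.+2 by rewrite -cardQ order_dvdG.
  case/(dvdn_pfactor _ _ (isT : prime 2)) => c; have := noQ g Qg.
  by rewrite leq_eqVlt => /[swap] /predU1P[-> /[swap] -> /eqP//|lec] _ ->; rewrite leq_exp2l.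
rewrite psiD psiA psiZ psiT cardG psi_Zp_coprime ?expn_gt0 ?coprimeXl ?coprimeXr //.
apply: leq_trans (leq_mul (leqnn 77) (leq_add (leq_mul psiQ (leqnn _)) (leqnn _))) _.
apply: (psi_bound_arith ((2 ^ a) ^ 2) ((3 ^ b) ^ 2)); rewrite ?expn_gt0 //.
- by rewrite -psi_Zp_pfactor.
- by rewrite -psi_Zp_pfactor.
- by rewrite psi_Zp_pfactor // (expnS 3) expnMn.
- by rewrite psi_Zp_pfactor // !(expnS 2); ring.
Qed.

(** * Passage to quotients and the final induction *)

(** With a Schur-Zassenhaus complement, [psi G] is at most [psi P * psi (G / P)], while [psi_Zp] is
    multiplicative on the coprime orders; the common factor [psi P] cancels. *)
Lemma psi_quotient_Sylow {gT : finGroupType} {p : nat} {P G : {group gT}} :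
    p.-Sylow(G) P -> P <| G -> cyclic P ->
    31 * psi_Zp #|G| < 77 * psi G ->
  31 * psi_Zp #|G / P| < 77 * psi (G / P).
Proof.
move=> sylP nPG cycP ltG; have hallP := pHall_Hall sylP.
have /splitsP[H /complP[tiPH defPH]] := SchurZassenhaus_split hallP nPG.
have nPH : H \subset 'N(P).
  by apply: subset_trans (normal_norm nPG); rewrite -defPH mulG_subr.
have defG : P ><| H = G by rewrite sdprodE.
have psiH : psi H = psi (G / P) := psi_isog (sdprod_isog defG).
have cardH : #|H| = #|G / P| := card_isog (sdprod_isog defG).
have coPH : coprime #|P| #|H|.
  by rewrite cardH card_quotient ?normal_norm //; case/andP: hallP.
have psiP := psi_cyclic cycP; have psiP_gt0 := psi_Zp_gt0 #|P|.
have le_psi := psi_cyclic_sdprod_le cycP defG.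
rewrite -(ltn_pmul2l psiP_gt0) -cardH -psiH.
rewrite -(sdprod_card defG) psi_Zp_coprime ?cardG_gt0 // in ltG.
rewrite psiP in le_psi; rewrite mulnCA; apply: leq_trans ltG _.
by rewrite [in X in _ <= X]mulnCA leq_mul2l le_psi orbT.
Qed.

(** Otherwise every element has order at most |G| / (B + 1), so [psi G] is at most |G|^2 / (B + 1),
    against the two bounds. *)
Lemma small_cyclic_index {gT : finGroupType} {G : {group gT}} B :
    77 * #|G| ^ 2 <= 31 * B.+1 * psi_Zp #|G| -> 31 * psi_Zp #|G| < 77 * psi G ->
  exists2 x, x \in G & #|G : <[x]>| <= B.
Proof.
move=> leB ltG; apply/exists_inP; apply: contraLR ltG; rewrite negb_exists_in -leqNgt.
move/forall_inP=> gtB; have le_psi : B.+1 * psi G <= #|G| * #|G|.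
  rewrite /psi big_distrr /= -sum_nat_const; apply: leq_sum => x Gx.
  have sxG : <[x]> \subset G by rewrite cycle_subG.
  by rewrite -(Lagrange sxG) mulnC leq_mul2l ltnNge gtB ?orbT.
rewrite -(leq_pmul2l (ltn0Sn B)) mulnCA; apply: leq_trans (_ : 77 * #|G| ^ 2 <= _).
  by rewrite leq_mul2l le_psi.
by rewrite mulnA [(B.+1 * 31)%N]mulnC.
Qed.

(** The normaliser of ['O_p(A)] contains [A], so its index is below [p]. *)
Lemma Sylow_cyclic_index_normal {gT : finGroupType} {p : nat} {A G : {group gT}} :
    A \subset G -> cyclic A -> prime p -> #|G : A| < p ->
  p.-Sylow(G) 'O_p(A) /\ 'O_p(A) <| G.
Proof.
move=> sAG cycA p_pr ltA; have abA := cyclic_abelian cycA.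
have p'A : ~~ (p %| #|G : A|).
  by apply/negP=> /(dvdn_leq (indexg_gt0 _ _)); rewrite leqNgt ltA.
have sylP : p.-Sylow(G) 'O_p(A).
  exact: Sylow_p'index sAG p'A (nilpotent_pcore_Hall p (abelian_nil abA)) p_pr.
split=> //; apply: Sylow_norm_index_le_normal p_pr sylP _.
apply: leq_trans (ltnW ltA); apply/(dvdn_leq (indexg_gt0 _ _))/indexgS.
by rewrite subsetI sAG gFnorm.
Qed.

Lemma psi_ratio_supersolvable {gT : finGroupType} {G : {group gT}} :
  31 * psi_Zp #|G| < 77 * psi G -> supersolvable G.
Proof.
(* The induction on the order generalises [gT], because [G / P] lives in another type. *)
move: {2}(#|G|).+1 (ltnSn #|G|) => n; elim: n gT G => // n IHn gT G; rewrite ltnS => leGn ltG.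
have [cycG|ncycG] := boolP (cyclic G); first exact: cyclic_supersolvable.
have G_gt1 : 1 < #|G| by rewrite cardG_gt1; apply: contraNneq ncycG => ->; apply: cyclic1.
set p := max_pdiv #|G|; have p_pr : prime p := max_pdiv_prime G_gt1.
have smG : smooth p #|G|.
  by move=> r r_pr rG; apply: max_pdiv_max; rewrite mem_primes r_pr cardG_gt0.
have reduce (P : {group gT}) : p.-Sylow(G) P -> P <| G -> cyclic P -> supersolvable G.
  move=> sylP nPG cycP; apply: (supersolvable_cyclic_ext nPG cycP); apply: IHn.
    apply: leq_trans leGn; rewrite ltn_quotient ?(pHall_sub sylP) //.
    rewrite -cardG_gt1 (card_Hall sylP) p_part_gt1 mem_primes p_pr cardG_gt0.
    exact: max_pdiv_dvd.
  exact: psi_quotient_Sylow sylP nPG cycP ltG.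
have index1 (A : {group gT}) : A \subset G -> cyclic A -> #|G : A| = 1%N -> supersolvable G.
  by move=> sAG cycA /eqP; rewrite indexg_eq1 => sGA; case/negP: ncycG; apply: cyclicS cycA.
have [p_gt4|] := ltnP 4 p.
  have leB := smooth_bound p _ (ltnW p_gt4) (cardG_gt0 G) smG.
  have [x Gx] := small_cyclic_index p leB ltG.
  have sxG : <[x]> \subset G by rewrite cycle_subG.
  rewrite leq_eqVlt => /predU1P[ix|ltx].
    by apply: (cyclic_prime_index_supersolvable sxG (cycle_cyclic x)); rewrite ix.
  have [sylP nPG] := Sylow_cyclic_index_normal sxG (cycle_cyclic x) p_pr ltx.
  exact: (reduce ('O_p(<[x]>))%G sylP nPG) (cyclicS (pcore_sub _ _) (cycle_cyclic x)).
have le3 (A : {group gT}) : A \subset G -> cyclic A -> #|G : A| <= 3 -> supersolvable G.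
  move=> sAG cycA; have := indexg_gt0 G A; case eqi: #|G : A| => [|[|i]] // _ lei.
    exact: index1 sAG cycA eqi.
  by apply: (cyclic_prime_index_supersolvable sAG cycA); rewrite eqi; case: i lei {eqi} => [|[|]].
move=> le_p4; have [p2|p3] : p = 2 \/ p = 3.
  by case: (p) p_pr le_p4 => [|[|[|[|[|?]]]]]; auto.
  (* Here 77 * 3 / 2 lies between 31 * 3 and 31 * 4, which gives index at most 3. *)
  have leB : 77 * #|G| ^ 2 <= 31 * 3.+1 * psi_Zp #|G|.
    by rewrite p2 in smG; have := smooth2_bound _ (cardG_gt0 G) smG; nia.
  have [x Gx] := small_cyclic_index 3 leB ltG.
  by apply: le3; rewrite ?cycle_subG ?cycle_cyclic.
(* Here 77 * 2 = 154 is just below 31 * 5 = 155, which gives index at most 4. *)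
have leB : 77 * #|G| ^ 2 <= 31 * 4.+1 * psi_Zp #|G|.
  by rewrite p3 in smG; have := smooth3_bound _ (cardG_gt0 G) smG; nia.
have [x Gx] := small_cyclic_index 4 leB ltG.
have sxG : <[x]> \subset G by rewrite cycle_subG.
have cycx := cycle_cyclic x.
rewrite leq_eqVlt => /predU1P[ix|]; last exact: le3.
have [nT|nnT] := boolP ('O_3(<[x]>) <| G).
  apply: (reduce ('O_3(<[x]>))%G) => //; last exact: cyclicS (pcore_sub _ _) cycx.
  have sylT := nilpotent_pcore_Hall 3 (abelian_nil (cyclic_abelian cycx)).
  by rewrite p3; apply: Sylow_p'index sxG _ sylT isT; rewrite ix.
rewrite p3 in smG; case: (psi_cyclic_index4 sxG cycx ix nnT smG) => //.
by rewrite leqNgt ltG.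
Qed.

(* C_n is realised as the cyclic group Zp n (integers mod n, of order n for n > 0).
   The hypothesis psi(G) > (31/77) psi(C_n) is written over the rationals. *)
Theorem mainTheorem1 (gT : finGroupType) (G : {group gT}) :
  ((31%:Q / 77%:Q) * (psi (Zp #|G|))%:R < (psi G)%:R)%R -> supersolvable G.
Proof.
move=> ltG; apply: psi_ratio_supersolvable; move: ltG.
rewrite -!pmulrn GRing.mulrAC Num.Theory.ltr_pdivrMr ?Num.Theory.ltr0n //.
by rewrite -!GRing.natrM Num.Theory.ltr_nat [(psi G * 77)%N]mulnC.
Qed.
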